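(* Let $F\in\mathcal{L}_1(S)$, let $p\in\mathbb{Z}$ and $q\ge 2$ be coprime integers, let $n\in\mathbb{N}$, and let $P$ be a lifted periodic orbit of $F$ with period $nq$ and rotation number $p/q$. Set $G:=F^q-p$ and, for $x\in P$ and $0\le i\le q-1$, $P_i(x):=\{F^i(x),G(F^i(x)),\dots,G^{n-1}(F^i(x))\}$. Assume that there exists $x\in P$ such that $\langle P_0(x)\rangle$ is homeomorphic to a $3$-star and $\langle P_1(x)\rangle\subset[\ell,\ell+1]\subset\mathbb{R}$ for some $\ell\in\mathbb{Z}$. Let $m\in\mathbb{Z}\cap\langle P_0(x)\rangle$ denote the branching point of $\langle P_0(x)\rangle$. Assume also that $P_0(x)$ is a periodic orbit of type $3$ of $G$, that $F^i(m)\in\langle P_i(x)\rangle$ for $i=0,1,\dots,q-1$, and that $G(m)=m$. Then $\mathrm{Per}(p/q,F)=q\cdot\mathbb{N}=\{qk:k\in\mathbb{N}\}$.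
   Context: $\mathbb{N}=\{1,2,3,\dots\}$. $S=\mathbb{R}\cup B\subset\mathbb{C}$, where $B=\{z\in\mathbb{C}:\mathrm{Re}(z)\in\mathbb{Z},\ \mathrm{Im}(z)\in[0,1]\}$ and $\mathbb{R}$ is the real axis. $\mathcal{L}_1(S)$ is the set of continuous maps $F:S\to S$ with $F(z+1)=F(z)+1$ for all $z\in S$. A point $z\in S$ is periodic (mod 1) for $F$ if $F^n(z)\in z+\mathbb{Z}$ for some $n\in\mathbb{N}$; the least such $n$ is its period (mod 1). Then $\{F^n(z)+k:n\ge0,k\in\mathbb{Z}\}$ is called a lifted periodic orbit of that period. The rotation number of $z\in S$ is $\rho_F(z)=\lim_{n\to\infty}\frac{\mathrm{Re}(F^n(z))-\mathrm{Re}(z)}{n}$ when it exists (it exists and is constant on a lifted periodic orbit, and is called the rotation number of that orbit). $\mathrm{Per}(\alpha,F)$ is the set of periods (mod 1) of all periodic (mod 1) points of $F$ with rotation number $\alpha$. For $K\subset S$, $\langle K\rangle$ is the convex hull of $K$: the smallest closed connected subset of $S$ containing $K$. A $3$-star is a union of three segments (spaces homeomorphic to $[0,1]$) whose only common point is a common endpoint, called its branching point. Each $P_i(x)$ is a true periodic orbit of $G$ of period $n$ (i.e. $G$ permutes it cyclically and it has $n$ elements). Type: let $Q$ be a true periodic orbit of $G$ whose convex hull is a $3$-star with branching point $y$. If $y\in Q$, $Q$ has type 1. Otherwise let $\mathrm{Br}$ be the set of connected components of $\langle Q\rangle\setminus\{y\}$ that meet $Q$; for $b\in\mathrm{Br}$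 let $\mathrm{sm}_b$ be the point of $Q\cap b$ closest to $y$ (i.e. $\langle\{y,\mathrm{sm}_b\}\rangle\cap Q=\{\mathrm{sm}_b\}$), and let $\phi(b)$ be the element of $\mathrm{Br}$ containing $G(\mathrm{sm}_b)$. Each period of a periodic orbit of $\phi:\mathrm{Br}\to\mathrm{Br}$ is called a type of $Q$. (Thus type 3 means that $\phi$ is a cyclic permutation of the three branches.) *)

(* Defs.v *)
(* MathComp-Analysis, over an arbitrary [R : realType]. *)
From HB Require Import structures.
From mathcomp Require Import all_boot all_order all_algebra.
From mathcomp Require Import all_classical all_reals all_analysis.
From mathcomp Require Export complex.

Set Implicit Arguments.
Unset Strict Implicit.
Unset Printing Implicit Defensive.

Import Order.TTheory GRing.Theory Num.Theory.
Import numFieldNormedType.Exports.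

Local Open Scope classical_set_scope.
Local Open Scope ring_scope.

(* The regular module [^o] is what carries the topology of the norm on the
   field [complex R]. *)
Notation plane R := ((complex R)^o) (only parsing).

Definition Sspace (R : realType) : set (plane R) :=
  [set z | complex.Im z = 0] `|`
  [set z | (exists k : int, complex.Re z = k%:~R) /\
           0 <= complex.Im z <= 1].

(* A self-map of S is represented by a map on the whole plane, of which only
   the restriction to S is constrained and used. *)
Definition L1 (R : realType) : set (plane R -> plane R) :=
  [set F | [/\ {within @Sspace R, continuous F},
               {homo F : z / @Sspace R z >-> @Sspace R z} &
               forall z, @Sspace R z -> F (z + 1) = F z + 1]].

Definition least_positive (p : nat -> Prop) (n : nat) : Prop :=
  [/\ (0 < n)%N, p n & forall k, (0 < k)%N -> p k -> (n <= k)%N].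

Definition mod1_period (R : realType) (F : plane R -> plane R)
    (z : plane R) (n : nat) : Prop :=
  least_positive (fun k => exists j : int, iter k F z = z + j%:~R) n.

Definition lifted_periodic_orbit (R : realType) (F : plane R -> plane R)
    (n : nat) (P : set (plane R)) : Prop :=
  exists z, [/\ @Sspace R z, mod1_period F z n &
    P = [set w | exists (k : nat) (j : int), w = iter k F z + j%:~R]].

Definition has_rotation_number (R : realType) (F : plane R -> plane R)
    (z : plane R) (alpha : R) : Prop :=
  (fun n => (complex.Re (iter n F z) - complex.Re z) / n%:R) @ \oo --> alpha.

Definition Per (R : realType) (alpha : R) (F : plane R -> plane R) : set nat :=
  [set n | exists z, [/\ @Sspace R z, mod1_period F z n &
                         has_rotation_number F z alpha]].

(* For nonempty K in S this intersection is itself closed and connected,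
   because S contains no simple closed curve. *)
Definition hull (R : realType) (K : set (plane R)) : set (plane R) :=
  smallest [set A | [/\ A `<=` @Sspace R, closed A & connected A]] K.

Definition homeomorphism_on (T U : topologicalType) (A : set T) (B : set U)
    (f : T -> U) : Prop :=
  {within A, continuous f} /\
  exists g : U -> T,
    [/\ {within B, continuous g},
        {homo f : x / A x >-> B x}, {homo g : y / B y >-> A y},
        {in A, cancel f g} & {in B, cancel g f}].

Definition segment_with_endpoint (R : realType) (A : set (plane R))
    (y : plane R) : Prop :=
  exists2 f : R -> plane R,
    homeomorphism_on (`[0, 1]%classic : set R) A f & f 0 = y \/ f 1 = y.

(* Since segments are themselves defined up to homeomorphism, being a 3-star
   with branching point y and being homeomorphic to one (by a map sending the
   branching point to y) are the same thing. *)
Definition three_star (R : realType) (X : set (plane R)) (y : plane R) : Prop :=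
  exists A1 A2 A3 : set (plane R),
    [/\ X = A1 `|` A2 `|` A3,
        [/\ segment_with_endpoint A1 y, segment_with_endpoint A2 y &
            segment_with_endpoint A3 y] &
        [/\ A1 `&` A2 = [set y], A1 `&` A3 = [set y] & A2 `&` A3 = [set y]]].

Definition true_periodic_orbit (R : realType) (G : plane R -> plane R)
    (n : nat) (Q : set (plane R)) : Prop :=
  exists2 z, least_positive (fun k => iter k G z = z) n &
             Q = [set iter k G z | k in `I_n].

Definition Br (R : realType) (Q : set (plane R)) (y : plane R) :
    set (set (plane R)) :=
  [set b | (exists2 z, (hull Q `\ y) z &
                       b = connected_component (hull Q `\ y) z) /\
           b `&` Q !=set0].

(* The first arguments of [xget] below are junk default values: for the orbits
   considered, [sm] and [phi] select elements that exist and are unique. *)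
Definition sm (R : realType) (Q : set (plane R)) (y : plane R)
    (b : set (plane R)) : plane R :=
  xget y [set s | [/\ Q s, b s & hull [set y; s] `&` Q = [set s]]].

Definition phi (R : realType) (G : plane R -> plane R) (Q : set (plane R))
    (y : plane R) (b : set (plane R)) : set (plane R) :=
  xget b [set c | Br Q y c /\ c (G (sm Q y b))].

(* [y] is meant to be the branching point of [hull Q], which is unique. *)
Definition has_type (R : realType) (G : plane R -> plane R)
    (Q : set (plane R)) (y : plane R) (t : nat) : Prop :=
  [/\ exists n, true_periodic_orbit G n Q,
      three_star (hull Q) y &
      (Q y /\ t = 1%N) \/
      (~ Q y /\
       exists2 b, Br Q y b &
                  least_positive (fun k => iter k (phi G Q y) b = b) t)].

(* Main.v *)
Require Import Defs.
From HB Require Import structures.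
From mathcomp Require Import all_boot all_order all_algebra.
From mathcomp Require Import all_classical all_reals all_analysis.
From mathcomp Require Import zify ring lra.

Set Implicit Arguments.
Unset Strict Implicit.
Unset Printing Implicit Defensive.

Import Order.TTheory GRing.Theory Num.Theory.
Import numFieldNormedType.Exports.

Local Open Scope classical_set_scope.
Local Open Scope ring_scope.

(** Why the theorem holds.

    A point with F^n(z) = z + j has rotation number j/n
    ([periodic_rotation]).  As p and q are coprime, rotation number p/q forces
    q | n, and the points of period qN with this rotation number are exactly
    the points of least period N of G = F^q - p ([period_multiple],
    [descend_period]).  So G must be shown to have points of every least
    period N.

    Factor G as g o F with g = F^(q-1) - p; then also F o g = G.  Let a_i
    (i mod 3) be the points of P_0 closest to m on the three branches of the
    star, numbered so that G(a_i) lies on branch i+1.  Any path of S from m to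
    G(a_i) runs through a_(i+1), and any path between G(a_i) and G(a_j), for
    distinct i and j, runs through m ([star_branches_order]).  This rests on S
    being a tree: a closed connected subset of S containing the ends of an
    injective path contains the path ([path_in_connected]).

    The map F folds the star onto a real segment: put c = F(m) and
    b_i = F(a_i), all of them in the hull of P_1.  The map g sends c to m and
    b_i to G(a_i); hence between c and b_i there is a point sent by g to
    a_(i+1), thus by G to b_(i+1), and between b_i and b_j there is a point
    sent by g to m, thus by G to c.  Working on this side of the factorization
    matters.  The interior of the segment has no branching point of S, so an
    image that leaves the segment does so through its ends, and clamping G to
    the segment gives an interval map whose periodic orbits are all orbits of
    G ([clamped_least_period]).

    What remains is a statement on interval maps ([branch_covering_periods]).
    Two of the three b_i lie on the same side of c, say c < b_i < b_j.  If G
    moves branch i to branch j, the segments from c to b_i and from b_i to b_j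
    give a horseshoe.  This always happens, for a suitable pair, when all three
    b_i are on one side.  Otherwise j is moved to i, and the third point b_k is
    beyond c; the segments then cover each other along loops of lengths 2 and
    3 that can be combined into a primitive loop of any length
    ([twist_periods]). *)

(** * Itineraries of interval maps *)

Lemma continuous_IVT (R : realType) (h : R -> R) x y v :
  continuous h -> x <= y ->
  (h x <= v <= h y) \/ (h y <= v <= h x) ->
  exists2 z, x <= z <= y & h z = v.
Proof.
move=> ch xy hv.
have [//||z zxy <-] := @IVT R h x y v xy.
- exact: continuous_subspaceT.
- by rewrite ge_min le_max; case: hv => /andP[-> ->]; rewrite ?orbT.
- by exists z => //; move: zxy; rewrite in_itv.
Qed.

Lemma last_crossing (R : realType) (h : R -> R) x y a :
  continuous h -> x <= y -> h x <= a -> a <= h y ->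
  exists z, [/\ x <= z <= y, h z = a & forall w, z < w <= y -> a < h w].
Proof.
move=> ch xy hx hy.
pose A := [set z | x <= z <= y] `&` (h @^-1` [set t | t <= a]).
have A0 : A !=set0 by exists x; split=> //=; rewrite lexx.
have clA : closed A.
  apply: closedI.
    rewrite (_ : [set z | _] = `[x, y]%classic); first exact: interval_closed.
    by apply/seteqP; split => z /=; rewrite in_itv.
  by apply: closed_comp => // z _; exact: ch.
have ubA : has_ubound A by exists y => z [/= /andP[]].
have [/= /andP[xs sy] hs] := clA _ (closure_sup A0 ubA).
have above w : sup A < w <= y -> a < h w.
  move=> /andP[sw wy]; rewrite ltNge; apply/negP => hw.
  have : w <= sup A.
    by apply: ub_le_sup => //; split=> //=; rewrite wy (le_trans xs (ltW sw)).
  by rewrite leNgt sw.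
have [|z /andP[sz zy] hz] := @continuous_IVT R h (sup A) y a ch sy.
  by left; rewrite hs.
exists (sup A); split=> //; first by rewrite xs.
have : z <= sup A.
  by apply: ub_le_sup => //; split=> /=; rewrite ?hz // zy (le_trans xs sz).
by move=> zs; rewrite -hz; congr h; apply/eqP; rewrite eq_le sz zs.
Qed.

Lemma continuous_flip (R : realType) (h : R -> R) :
  continuous h -> continuous (fun t => - h (- t)).
Proof.
move=> ch t; apply: (@continuousN _ _ _ (fun s => h (- s))).
by apply: (@continuous_comp _ _ _ -%R h); [exact: oppr_continuous|exact: ch].
Qed.

Lemma first_crossing (R : realType) (h : R -> R) x y a :
  continuous h -> x <= y -> h x <= a -> a <= h y ->
  exists z, [/\ x <= z <= y, h z = a & forall w, x <= w < z -> h w < a].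
Proof.
move=> ch xy hx hy.
have [|||z [/andP[yz zx] hz above]] :=
  @last_crossing R _ (- y) (- x) (- a) (continuous_flip ch).
- by rewrite lerN2.
- by rewrite opprK lerN2.
- by rewrite opprK lerN2.
exists (- z); split; first by apply/andP; split; lra.
  by apply: oppr_inj.
move=> w /andP[xw wz]; have := above (- w); rewrite opprK ltrN2; apply.
by apply/andP; split; lra.
Qed.

(** An interval is a pair of endpoints.  Covering is asked of the images of the
    endpoints, which makes it pass to subintervals of J and lets the
    intermediate value theorem do the rest. *)
Definition covers (R : realType) (h : R -> R) (I J : R * R) :=
  (h I.1 <= J.1 /\ J.2 <= h I.2) \/ (h I.2 <= J.1 /\ J.2 <= h I.1).

(** Between the last crossing of one end of J and the following first crossing
    of the other, h stays in J. *)
Lemma covers_exactly (R : realType) (h : R -> R) (I J : R * R) :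
  continuous h -> I.1 <= I.2 -> J.1 <= J.2 -> covers h I J ->
  exists a b, [/\ I.1 <= a, a <= b, b <= I.2,
    forall z, a <= z <= b -> J.1 <= h z <= J.2 &
    (h a = J.1 /\ h b = J.2) \/ (h a = J.2 /\ h b = J.1)].
Proof.
move=> ch I12 J12 [[h1 h2]|[h1 h2]].
- have [|a [/andP[Ia aI] ha above]] := last_crossing ch I12 h1.
    exact: le_trans h2.
  have [|b [/andP[ab bI] hb below]] := first_crossing ch aI _ h2.
    by rewrite ha.
  exists a, b; split=> //; last by left.
  move=> z /andP[az zb]; apply/andP; split.
    move: az; rewrite le_eqVlt => /predU1P[<-|az]; first by rewrite ha.
    by apply/ltW/above; rewrite az (le_trans zb bI).
  move: zb; rewrite le_eqVlt => /predU1P[->|zb]; first by rewrite hb.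
  by apply/ltW/below; rewrite az.
- have I12' : - I.2 <= - I.1 by rewrite lerN2.
  pose k t := h (- t).
  have ck : continuous k.
    move=> t; apply: (@continuous_comp _ _ _ -%R h); last exact: ch.
    exact: oppr_continuous.
  have k1 : k (- I.2) <= J.1 by rewrite /k opprK.
  have k2 : J.2 <= k (- I.1) by rewrite /k opprK.
  have [|a [/andP[Ia aI] ha above]] := last_crossing ck I12' k1.
    exact: le_trans k2.
  have [|b [/andP[ab bI] hb below]] := first_crossing ck aI _ k2.
    by rewrite ha.
  exists (- b), (- a); split; [lra..| |by right].
  move=> z /andP[az zb]; apply/andP; rewrite -(opprK z) -/(k (- z)); split.
    have : a <= - z by lra.
    rewrite le_eqVlt => /predU1P[<-|az']; first by rewrite ha.
    by apply/ltW/above; rewrite az' /=; lra.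
  have : - z <= b by lra.
  rewrite le_eqVlt => /predU1P[->|zb']; first by rewrite hb.
  by apply/ltW/below; rewrite zb' andbT; lra.
Qed.

Lemma itinerary_interval (R : realType) (h : R -> R) (N : nat)
    (I : nat -> R * R) :
  continuous h -> (forall s, (I s).1 <= (I s).2) ->
  (forall s, (s < N)%N -> covers h (I s) (I s.+1)) ->
  exists a b, [/\ (I 0).1 <= a, a <= b, b <= (I 0).2,
    forall z, a <= z <= b -> forall s, (s <= N)%N ->
      (I s).1 <= iter s h z <= (I s).2 &
    (iter N h a = (I N).1 /\ iter N h b = (I N).2) \/
    (iter N h a = (I N).2 /\ iter N h b = (I N).1)].
Proof.
move=> ch; elim: N I => [|N IHN] I leI covI.
  exists (I 0).1, (I 0).2; split=> //; last by left.
  by move=> z zI [].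
have [||a1 [b1 [Ia1 ab1 bI1 itin1 ends1]]] := IHN (fun s => I s.+1).
- by move=> s; exact: leI.
- by move=> s sN; exact: covI.
have [|a [b [Ia ab bI hab ends]]] :=
    @covers_exactly R h (I 0) (a1, b1) ch (leI 0) ab1.
  have := covI 0%N isT.
  case=> -[/= h1 h2]; [left|right]; rewrite /= (le_trans h1 Ia1) //;
    by rewrite (le_trans bI1 h2).
exists a, b; split=> //.
- move=> z zab [_|s sN].
    by case/andP: zab => az zb; rewrite /= (le_trans Ia az) (le_trans zb bI).
  by rewrite iterSr; apply: itin1 => //; exact: hab.
- rewrite !iterSr; case: ends => -[/= -> ->] //.
  by case: ends1 => -[e1 e2]; [right|left].
Qed.

(** A closed chain of coverings is followed by a periodic point: the return map
    sends the endpoints of the interval of points having the given itinerary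
    onto the endpoints of an interval that contains it, so it has a fixed
    point there. *)
Lemma itinerary_fixed_point (R : realType) (h : R -> R) (N : nat)
    (I : nat -> R * R) :
  continuous h -> (forall s, (I s).1 <= (I s).2) -> I N = I 0 ->
  (forall s, (s < N)%N -> covers h (I s) (I s.+1)) ->
  exists2 z, iter N h z = z &
    forall s, (s <= N)%N -> (I s).1 <= iter s h z <= (I s).2.
Proof.
move=> ch leI IN covI.
have [a [b [Ia ab bI itin ends]]] := itinerary_interval ch leI covI.
rewrite IN in ends.
have cN : continuous (fun t => iter N h t - t).
  move=> t; apply: continuousB; last exact: cvg_id.
  elim: {itin ends IN covI} N => [|N IHN]; first exact: cvg_id.
  by apply: (@continuous_comp _ _ _ (iter N h) h); [exact: IHN|exact: ch].
have [|z zab hz] := @continuous_IVT R _ a b 0 cN ab.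
  by case: ends => -[-> ->]; [left|right]; apply/andP; split; lra.
exists z; last exact: itin.
by apply/eqP; rewrite -subr_eq0 hz.
Qed.

(** * Two loop patterns with points of all periods *)

(** Both [c, t] and [t, u] cover their union.  The itinerary that visits [t, u]
    once and [c, t] otherwise is primitive; the intervals meet at t only, whose
    image lies outside both. *)
Lemma horseshoe_periods (R : realType) (h : R -> R) (c t u : R) (N : nat) :
  continuous h -> c < t -> t < u -> h c = c -> u < h t -> h u = c ->
  (0 < N)%N -> exists z, least_positive (fun k => iter k h z = z) N.
Proof.
move=> ch ct tu hc ht hu N0.
pose I s := if (0 < s < N)%N then (c, t) else (t, u).
have [|||z hz itin] := @itinerary_fixed_point R h N I ch.
- by move=> s; rewrite /I; case: ifP => _ /=; exact: ltW.
- by rewrite /I ltnn andbF.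
- move=> s _; have [J1 J2] : c <= (I s.+1).1 /\ (I s.+1).2 <= u.
    by rewrite /I; case: ifP => _ /=; split; lra.
  rewrite {1}/I; case: ifP => _; [left|right] => /=; split; lra.
exists z; split=> // M M0 hM; rewrite leqNgt; apply/negP => MN.
have := itin 0%N isT; rewrite /I /= => /andP[tz _].
have := itin M (ltnW MN); rewrite /I M0 MN hM /= => /andP[_ zt].
have zE : z = t by apply/eqP; rewrite eq_le zt tz.
have N1 : (1 < N)%N by exact: leq_ltn_trans MN.
have := itin 1%N N0; rewrite /I N1 /= zE => /andP[_]; lra.
Qed.

(** With A = [c, t], B = [t, u], C = [u, v] and D = [w, c], the coverings are
    A -> D, B -> D, C -> A, and D -> A, B, C.  The itineraries are
    B D (A D) ... (A D) for even N and C A D (A D) ... (A D) for odd N > 1;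
    the first interval is visited once, which makes N the least period. *)
Lemma twist_periods (R : realType) (h : R -> R) (c t u v w : R) (N : nat) :
  continuous h -> w < c -> c < t -> t < u -> u < v ->
  h c = c -> h t <= w -> h u = c -> t <= h v -> v <= h w ->
  (0 < N)%N -> exists z, least_positive (fun k => iter k h z = z) N.
Proof.
move=> ch wc ct tu uv hc ht hu hv hw N0.
have covD J : c <= J.1 -> J.2 <= v -> covers h (w, c) J.
  by move=> J1 J2; right => /=; split; lra.
have covAD : covers h (c, t) (w, c) by right => /=; split; lra.
have covBD : covers h (t, u) (w, c) by left => /=; split; lra.
have covCA : covers h (u, v) (c, t) by left => /=; split; lra.
have [N1|N1] := leqP N 1.
  have -> : N = 1%N by apply/eqP; rewrite eqn_leq N1 N0.
  by exists c; split.
have [oddN|evenN] := boolP (odd N).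
- pose I s := if ~~ (0 < s < N)%N then (u, v)
              else if odd s then (c, t) else (w, c).
  have [|||z hz itin] := @itinerary_fixed_point R h N I ch.
  + move=> s; rewrite /I; case: ifP => _ /=; first exact: ltW.
    by case: ifP => _ /=; exact: ltW.
  + by rewrite /I ltnn andbF.
  + move=> [|s] sN; first by rewrite /I /= N1.
    rewrite /I sN /=; case: ifP => os.
      have -> /= : (s.+2 < N)%N.
        by rewrite ltn_neqAle sN andbT; apply: contraL oddN => /eqP <- /=; rewrite negbK.
      by rewrite ?os.
    by apply: covD; rewrite /= ?os /=; case: ifP => //= _; lra.
  exists z; split=> // M M0 hM; rewrite leqNgt; apply/negP => MN.
  have := itin 0%N isT; rewrite /I /= => /andP[uz _].
  have := itin M (ltnW MN); rewrite /I M0 MN hM /=.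
  by case: ifP => _ /= /andP[_ zt]; lra.
- pose I s := if ~~ (0 < s < N)%N then (t, u)
              else if odd s then (w, c) else (c, t).
  have [|||z hz itin] := @itinerary_fixed_point R h N I ch.
  + move=> s; rewrite /I; case: ifP => _ /=; first exact: ltW.
    by case: ifP => _ /=; exact: ltW.
  + by rewrite /I ltnn andbF.
  + move=> [|s] sN; first by rewrite /I /= N1.
    rewrite /I sN /=; case: ifP => os.
      by apply: covD; rewrite /= ?os /=; case: ifP => //= _; lra.
    have -> /= : (s.+2 < N)%N.
      rewrite ltn_neqAle sN andbT; apply: contraNN evenN => /eqP <- /=.
      by rewrite ?os.
    by rewrite ?os.
  exists z; split=> // M M0 hM; rewrite leqNgt; apply/negP => MN.
  have := itin 0%N isT; rewrite /I /= => /andP[tz _].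
  have := itin M (ltnW MN); rewrite /I M0 MN hM /=.
  case: ifP => [_ /= /andP[_ zt]|oM /= /andP[_ zt]]; first by lra.
  (* The two intervals share the endpoint t, whose orbit leaves the
     itinerary at once. *)
  have zE : z = t by apply/eqP; rewrite eq_le zt tz.
  have := itin 1%N (ltnW N1); rewrite /I N1 /= zE => /andP[wh _].
  have htw : h t = w by apply/eqP; rewrite eq_le ht wh.
  have := itin 2%N N1; rewrite /I /= zE htw.
  by case: ifP => _ /= /andP[_ ?]; lra.
Qed.

(** * Interval maps permuting three branches *)

(** The interval map left over from the star after folding: Z stands for the set
    of points whose image under g is the branching point, c for the image of
    that point, and b i for the image of the closest point of branch i, where
    branch i is moved to branch i + 1 (mod 3). *)
Record branch_covering (R : realType) (h : R -> R) (Z : set R) (c : R)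
    (b : 'I_3 -> R) : Prop := BranchCovering {
  bc_center : Z c;
  bc_collapse : forall u, Z u -> h u = c;
  bc_cover : forall u i, Z u ->
    exists2 v, Num.min u (b i) <= v <= Num.max u (b i) & h v = b (i + 1);
  bc_separate : forall i j, i != j ->
    exists2 u, Num.min (b i) (b j) <= u <= Num.max (b i) (b j) & Z u;
  bc_off : forall i, ~ Z (b i) }.

Lemma branch_covering_flip (R : realType) (h : R -> R) (Z : set R) (c : R)
    (b : 'I_3 -> R) :
  branch_covering h Z c b ->
  branch_covering (fun t => - h (- t)) [set u | Z (- u)] (- c)
    (fun i => - b i).
Proof.
case=> Zc Zh cov sep off; split=> /=.
- by rewrite opprK.
- by move=> u /Zh ->.
- move=> u i Zu; have [v uv hv] := cov _ i Zu; exists (- v); last by rewrite opprK hv.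
  move: uv; rewrite !minEle !maxEle.
  by case: ifP => ? /andP[? ?]; case: ifP => ?; apply/andP; split; lra.
- move=> i j /sep [u ub Zu]; exists (- u); last by rewrite opprK.
  move: ub; rewrite !minEle !maxEle.
  by case: ifP => ? /andP[? ?]; case: ifP => ?; apply/andP; split; lra.
- by move=> i; rewrite opprK.
Qed.

Lemma cycle3 (i j : 'I_3) : i != j -> (i + 1 = j \/ j + 1 = i).
Proof.
by case: i j => [[|[|[|//]]] ?] [[|[|[|//]]] ?] //= _;
   ((left; exact: val_inj) || (right; exact: val_inj)).
Qed.

Lemma add3 (i : 'I_3) : i + 1 + 1 + 1 = i.
Proof. by case: i => [[|[|[|//]]] ?]; exact: val_inj. Qed.

Lemma neq_succ3 (i : 'I_3) : i != i + 1.
Proof. by case: i => [[|[|[|//]]] ?]. Qed.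

(** When the branch of the nearer point b i is moved to that of a farther one
    there is a horseshoe.  Otherwise b j is moved to b i; if the third point
    were also above c, it would take part in a pair of the first kind. *)
Lemma same_side_periods (R : realType) (h : R -> R) (Z : set R) (c : R)
    (b : 'I_3 -> R) (i j : 'I_3) (N : nat) :
  continuous h -> branch_covering h Z c b -> c < b i -> b i < b j ->
  (0 < N)%N -> exists z, least_positive (fun k => iter k h z = z) N.
Proof.
move=> ch bc ci ij N0.
have [Zc Zh cov sep off] := bc.
have hc := Zh _ Zc.
have offc k : b k != c by apply/eqP => bk; apply: (off k); rewrite bk.
have neq_lt_index i' j' : b i' < b j' -> i' != j'.
  by apply: contraTneq => ->; rewrite ltxx.
have cross i' j' : c < b i' -> b i' < b j' ->
    exists t u v, [/\ c < t <= b i', b i' < u, u < v, v <= b j' &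
      [/\ h t = b (i' + 1), h u = c & h v = b (j' + 1)]].
  move=> ci' ij'.
  have [t + ht] := cov c i' Zc.
  rewrite (min_idPl (ltW ci')) (max_idPr (ltW ci')) => /andP[ct ti].
  have [u + Zu] := sep i' j' (neq_lt_index _ _ ij').
  rewrite (min_idPl (ltW ij')) (max_idPr (ltW ij')) => /andP[iu uj].
  have [v + hv] := cov u j' Zu.
  rewrite (min_idPl uj) (max_idPr uj) => /andP[uv vj].
  exists t, u, v; split=> //; first rewrite ti andbT lt_neqAle ct andbT.
  - by apply: contraTN isT => /eqP tc; rewrite -tc hc in ht;
      move/eqP: (offc (i' + 1)); rewrite ht.
  - rewrite lt_neqAle iu andbT; apply/eqP => e; apply: (off i').
    by rewrite e.
  - rewrite lt_neqAle uv andbT; apply/eqP => e.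
    by move/eqP: (offc (j' + 1)); rewrite -hv -e (Zh _ Zu).
  - by split=> //; exact: Zh.
have forward i' : c < b i' -> b i' < b (i' + 1) ->
    exists z, least_positive (fun k => iter k h z = z) N.
  move=> ci' ij'.
  have [t [u [v [/andP[ct ti] iu uv vj [ht hu _]]]]] := cross _ _ ci' ij'.
  apply: (@horseshoe_periods R h c t u) => //.
    exact: le_lt_trans iu.
  by rewrite ht; exact: lt_le_trans vj.
have ineqj := neq_lt_index _ _ ij.
have [e|e] := cycle3 ineqj; first by apply: (forward i); rewrite ?e.
pose k := i + 1.
have kj : k + 1 = j by rewrite -[RHS]add3 e.
have [kc|ck|kc] := ltgtP (b k) c; last by move/eqP: (offc k); rewrite kc.
  have [t [u [v [/andP[ct ti] iu uv vj [ht hu hv]]]]] := cross _ _ ci ij.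
  have [w + hw] := cov c k Zc.
  rewrite (min_idPr (ltW kc)) (max_idPl (ltW kc)) => /andP[kw wc].
  rewrite kj in hw; rewrite e in hv.
  apply: (@twist_periods R h c t u v w) => //; rewrite ?hw ?ht ?hv //.
    rewrite lt_neqAle wc andbT; apply/eqP => ew.
    by move/eqP: (offc j); rewrite -hw ew.
  exact: le_lt_trans iu.
have [ik|ki] := ltP (b i) (b k); first exact: (forward i).
apply: (forward k) => //; rewrite kj; exact: le_lt_trans ij.
Qed.

Lemma branch_covering_periods (R : realType) (h : R -> R) (Z : set R) (c : R)
    (b : 'I_3 -> R) (N : nat) :
  continuous h -> branch_covering h Z c b -> (0 < N)%N ->
  exists z, least_positive (fun k => iter k h z = z) N.
Proof.
move=> ch bc N0.
have offc k : b k != c.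
  by apply/eqP => bk; apply: (bc_off bc (i := k)); rewrite bk; exact: bc_center bc.
have bneq i j : i != j -> b i != b j.
  move=> ij; apply/eqP => e; have [u + Zu] := bc_separate bc ij.
  rewrite e minxx maxxx => /le_anti ue.
  by apply: (bc_off bc (i := j)); rewrite ue.
have side (i j : 'I_3) : i != j -> c < b i -> c < b j ->
    exists z, least_positive (fun k => iter k h z = z) N.
  move=> ij ci cj; have := bneq _ _ ij; rewrite neq_lt => /orP[lt|lt].
    exact: (same_side_periods ch bc ci lt).
  exact: (same_side_periods ch bc cj lt).
have sideN (i j : 'I_3) : i != j -> b i < c -> b j < c ->
    exists z, least_positive (fun k => iter k h z = z) N.
  move=> ij ci cj.
  have flip z k : iter k (fun t => - h (- t)) z = - iter k h (- z).
    elim: k => [|k IH]; first by rewrite /= opprK.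
    by rewrite !iterS IH opprK.
  have [z [_ hz least]] :
      exists z, least_positive (fun k => iter k (fun t => - h (- t)) z = z) N.
    have bc' := branch_covering_flip bc; have ch' := continuous_flip ch.
    have := bneq _ _ ij; rewrite neq_lt => /orP[lt|lt].
      by apply: (same_side_periods (i := j) (j := i) ch' bc'); rewrite ?ltrN2.
    by apply: (same_side_periods (i := i) (j := j) ch' bc'); rewrite ?ltrN2.
  exists (- z); split=> //; first by rewrite -{2}hz flip opprK.
  by move=> k k0 hk; apply: least => //; rewrite flip hk opprK.
pose i0 : 'I_3 := 0; pose i1 : 'I_3 := 1; pose i2 : 'I_3 := 1 + 1.
have := offc i0; have := offc i1; have := offc i2; rewrite !neq_lt.
move=> /orP[l2|l2] /orP[l1|l1] /orP[l0|l0].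
all: by [apply: (sideN i0 i1)|apply: (sideN i0 i2)|apply: (sideN i1 i2)
        |apply: (side i0 i1)|apply: (side i0 i2)|apply: (side i1 i2)].
Qed.

(** * The topology of S *)

Section plane_topology.
Variable R : realType.
Implicit Types (z w : plane R) (x y : R) (k : int).

Definition on_axis x : plane R := Complex x 0.

Lemma ReD z w : complex.Re (z + w) = complex.Re z + complex.Re w.
Proof. by case: z w => [? ?] [? ?]. Qed.

Lemma ImD z w : complex.Im (z + w) = complex.Im z + complex.Im w.
Proof. by case: z w => [? ?] [? ?]. Qed.

Lemma ReB z w : complex.Re (z - w) = complex.Re z - complex.Re w.
Proof. by case: z w => [? ?] [? ?]. Qed.

Lemma ImB z w : complex.Im (z - w) = complex.Im z - complex.Im w.
Proof. by case: z w => [? ?] [? ?]. Qed.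

Lemma intr_on_axis k : (k%:~R : plane R) = on_axis k%:~R.
Proof. exact: esym (rmorph_int (real_complex R) k). Qed.

Lemma plane_ext z w :
  complex.Re z = complex.Re w -> complex.Im z = complex.Im w -> z = w.
Proof. by case: z w => [? ?] [? ?] /= -> ->. Qed.

Lemma near_plane_dist z (e : R[i]) : 0 < e -> \forall w \near z, `|z - w| < e.
Proof. by move=> e0; apply/nbhs_ballP; exists e => // w; rewrite -ball_normE. Qed.

Lemma Re_continuous : continuous (fun z : plane R => complex.Re z).
Proof.
move=> z; apply/(@cvgrPdist_lt _ _ _ _ (nbhs_filter z)) => e e0.
have e0' : 0 < (e%:C)%C :> R[i] by rewrite ltcR.
near=> w; rewrite -ReB -ltcR; apply: le_lt_trans (normc_ge_Re _) _.
by near: w; exact: near_plane_dist.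
Unshelve. all: by end_near. Qed.

Lemma Im_continuous : continuous (fun z : plane R => complex.Im z).
Proof.
move=> z; apply/(@cvgrPdist_lt _ _ _ _ (nbhs_filter z)) => e e0.
have e0' : 0 < (e%:C)%C :> R[i] by rewrite ltcR.
near=> w; rewrite -ImB.
have := normc_ge_Re ((z - w) * 'i%C); rewrite ReiNIm normrN normrM.
have -> : `|'i%C : R[i]| = 1.
  by rewrite normc_def /= expr0n add0r expr1n sqrtr1.
rewrite mulr1 -ltcR => /le_lt_trans; apply.
by near: w; exact: near_plane_dist.
Unshelve. all: by end_near. Qed.

Lemma Complex_continuous (f g : R -> R) :
  continuous f -> continuous g ->
  continuous (fun x => Complex (f x) (g x) : plane R).
Proof.
move=> cf cg x.
have cC (h : R -> R) : continuous h -> continuous (fun x => (h x)%:C%C : plane R).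
  move=> ch {}x; apply/(@cvgrPdist_lt _ _ _ _ (nbhs_filter x)) => e e0.
  have /andP[eI e0'] : (complex.Im e == 0) && (0 < complex.Re e).
    by move: e0; rewrite ltcE /= eq_sym.
  near=> w; rewrite -rmorphB /= normc_def /= expr0n addr0 sqrtr_sqr.
  rewrite ltcE /= (eqP eI) eqxx /=.
  by near: w; exact: (@cvgr_dist_lt _ _ _ _ _ h (h x) (ch x)).
have -> : (fun x => Complex (f x) (g x) : plane R) =
    (fun x => (f x)%:C%C + ('i%C : R[i]) *: ((g x)%:C%C : plane R)).
  by apply/funext => y; rewrite [LHS]complexE.
apply: (@continuousD _ (plane R) _ (fun x => (f x)%:C%C : plane R)
  (fun x => ('i%C : R[i]) *: ((g x)%:C%C : plane R))).
  exact: cC.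
by apply: cvgZr; exact: (cC g).
Unshelve. all: by end_near. Qed.

Lemma on_axis_continuous : continuous on_axis.
Proof. by apply: Complex_continuous => x; [exact: cvg_id|exact: cvg_cst]. Qed.

End plane_topology.

(** The retraction of the real line onto [lo, hi]. *)
Definition clamp (R : realType) (lo hi x : R) : R := Num.max lo (Num.min hi x).

Lemma clamp_bounds (R : realType) (lo hi x : R) :
  lo <= hi -> lo <= clamp lo hi x <= hi.
Proof.
by move=> lohi; rewrite /clamp le_max lexx ge_max lohi ge_min lexx.
Qed.

Lemma clamp_id (R : realType) (lo hi x : R) :
  lo <= x <= hi -> clamp lo hi x = x.
Proof.
by move=> /andP[lox xhi]; rewrite /clamp (min_idPr xhi) (max_idPr lox).
Qed.

Lemma clamp_interior (R : realType) (lo hi x : R) :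
  lo < clamp lo hi x < hi -> clamp lo hi x = x.
Proof.
rewrite /clamp; have [hx|xh] := leP hi x; have [lx|xl] := leP lo _;
  by rewrite ?ltxx ?andbF.
Qed.

Lemma clamp_continuous (R : realType) (lo hi : R) : continuous (clamp lo hi).
Proof.
move=> x; apply: (@continuous_max R R (fun=> lo) (fun t => Num.min hi t)).
  exact: cvg_cst.
by apply: (@continuous_min R R (fun=> hi) id); [exact: cvg_cst|exact: cvg_id].
Qed.

Lemma continuous_comp_within (T U V : topologicalType) (k : T -> U)
    (f : U -> V) (A : set U) :
  continuous k -> (forall x, A (k x)) -> {within A, continuous f} ->
  continuous (f \o k).
Proof.
move=> ck kA /subspace_continuousP cf x.
apply: (@cvg_comp _ _ _ k f _ (within A (nbhs (k x)))); last exact: cf.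
move=> P wP; have := ck x _ wP.
by apply: (@filterS _ (nbhs x)) => t /(_ (kA t)).
Qed.

Section S_topology.
Variable R : realType.
Implicit Types (z w : plane R) (x y : R) (k : int).
Local Notation S := (@Sspace R).

Lemma S_on_axis x : S (on_axis x).
Proof. by left. Qed.

Lemma S_int k : S (k%:~R).
Proof. by rewrite intr_on_axis; exact: S_on_axis. Qed.

Lemma S_shift z k : S z -> S (z + k%:~R).
Proof.
rewrite intr_on_axis => -[/= zi|/= [[j zr] zi]].
  by left; rewrite /= ImD zi /= addr0.
right => /=; rewrite ImD ReD /= addr0; split=> //.
by exists (j + k); rewrite zr intrD.
Qed.

Lemma S_off_int z : S z ->
  (forall k, complex.Re z != k%:~R) -> z = on_axis (complex.Re z).
Proof.
move=> [/= zi _|/= [[k zk] _] /(_ k)]; last by rewrite zk eqxx.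
by apply: plane_ext.
Qed.

Lemma between_ints x j k :
  j%:~R < x < (j + 1)%:~R -> x != k%:~R.
Proof.
move=> /andP[jx xj]; apply/eqP => xk; move: jx xj; rewrite xk !ltr_int; lia.
Qed.

Lemma closed_S : closed S.
Proof.
have cl0 (f : plane R -> R) (D : set R) : continuous f -> closed D ->
    closed (f @^-1` D) by move=> cf cD; apply: closed_comp => // z _; exact: cf.
have -> : S = (fun z : plane R => complex.Im z) @^-1` [set 0] `|`
    ((fun z : plane R => complex.Re z) @^-1` [set x | exists k : int, x = k%:~R] `&`
     (fun z : plane R => complex.Im z) @^-1` `[0, 1]%classic).
  by apply/seteqP; split => z; rewrite /Sspace /= in_itv.
apply: closedU; first by apply: cl0; [exact: Im_continuous|exact: closed_eq].
apply: closedI; last by apply: cl0; [exact: Im_continuous|exact: interval_closed].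
apply: cl0; first exact: Re_continuous.
move=> x clx /=; exists (Num.floor x).
apply/eqP; rewrite eq_le floor_le_tmp andbT leNgt; apply/negP => fx.
have xI : x \in `](Num.floor x)%:~R, (Num.floor x + 1)%:~R[.
  by rewrite in_itv /= fx floorD1_gt.
have [_ [[k ->]]] := clx _ (near_in_itvoo xI).
by rewrite /= in_itv /= => /(@between_ints _ _ k); rewrite eqxx.
Qed.

Lemma connected_axis_segment (D : set R) :
  is_interval D -> connected (@on_axis R @` D).
Proof.
move=> iD; apply: connected_continuous_connected; first exact/connected_intervalP.
exact/continuous_subspaceT/on_axis_continuous.
Qed.

Lemma connected_S : connected S.
Proof.
pose axis := @on_axis R @` setT.
pose stem k : set (plane R) := (fun y => Complex k%:~R y) @` `[0, 1]%classic.
have -> : S = \bigcup_(k in [set: int]) (axis `|` stem k).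
  apply/seteqP; split => z.
    move=> [/= zi|/= [[k zk] zi]].
      by exists 0 => //; left; exists (complex.Re z) => //; exact: plane_ext.
    exists k => //; right; exists (complex.Im z); rewrite /= ?in_itv //.
    exact: plane_ext.
  move=> [k _ [[x _ <-]|[y yi <-]]]; first exact: S_on_axis.
  by right; split => /=; [exists k|move: yi; rewrite /= in_itv].
have ax : connected axis by exact: connected_axis_segment.
apply: bigcup_connected.
  by exists (on_axis 0) => k _; left; exists 0.
move=> k _; apply: connectedU => //.
  exists (on_axis k%:~R); split; first by exists k%:~R.
  by exists 0 => //=; rewrite in_itv /= lexx ler01.
apply: connected_continuous_connected; first exact: segment_connected.
apply/continuous_subspaceT/Complex_continuous => x; [exact: cvg_cst|exact: cvg_id].
Qed.

End S_topology.

(** * S is a tree *)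

(** A function that takes each value near v s at most once cannot turn back at
    s: a value slightly beyond v s would be taken on both sides of s. *)
Lemma injective_value_crossing (R : realType) (v : R -> R) (a s b al be : R) :
  continuous v -> a <= s <= b ->
  (forall r r', a <= r <= b -> a <= r' <= b -> v r = v r' ->
     al < v r < be -> r = r') ->
  al < v s < be -> (v a <= v s <= v b) \/ (v b <= v s <= v a).
Proof.
move=> cv /andP[sa sb] inj /andP[als sbe].
have turn d : al < d < be -> d != v s ->
    (v a <= d <= v s) \/ (v s <= d <= v a) ->
    (v s <= d <= v b) \/ (v b <= d <= v s) -> False.
  move=> dI ds da db.
  have [r /andP[ar rs] vr] := continuous_IVT cv sa da.
  have [r' /andP[sr rb] vr'] := continuous_IVT cv sb db.
  have rr : r = r'.
    by apply: inj; rewrite ?vr ?vr' ?ar ?rb ?(le_trans rs sb) ?(le_trans sa sr).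
  move/eqP: ds; apply; rewrite -vr; congr v.
  by apply/eqP; rewrite eq_le rs rr sr.
have [va|va] := leP (v a) (v s); have [vb|vb] := leP (v b) (v s).
- have [->|nb] := eqVneq (v b) (v s); first by left; rewrite ?va lexx.
  have [->|na] := eqVneq (v a) (v s); first by right; rewrite ?vb lexx.
  pose d := (Num.max al (Num.max (v a) (v b)) + v s) / 2.
  have md : Num.max al (Num.max (v a) (v b)) < v s.
    by rewrite !gt_max als !lt_neqAle na nb va vb.
  have /and3P[d1 d2 d3] : [&& al <= Num.max al (Num.max (v a) (v b)),
      v a <= Num.max al (Num.max (v a) (v b)) &
      v b <= Num.max al (Num.max (v a) (v b))].
    by rewrite !le_max !lexx !orbT.
  exfalso; apply: (turn d); rewrite /d; [apply/andP; split; lra| | |].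
  + by rewrite lt_eqF //; lra.
  + by left; apply/andP; split; lra.
  + by right; apply/andP; split; lra.
- by left; rewrite ?va ltW.
- by right; rewrite ?vb ltW.
- pose d := (Num.min be (Num.min (v a) (v b)) + v s) / 2.
  have md : v s < Num.min be (Num.min (v a) (v b)).
    by rewrite !lt_min sbe va vb.
  have /and3P[d1 d2 d3] : [&& Num.min be (Num.min (v a) (v b)) <= be,
      Num.min be (Num.min (v a) (v b)) <= v a &
      Num.min be (Num.min (v a) (v b)) <= v b].
    by rewrite !ge_min !lexx !orbT.
  exfalso; apply: (turn d); rewrite /d; [apply/andP; split; lra| | |].
  + by rewrite gt_eqF //; lra.
  + by right; apply/andP; split; lra.
  + by left; apply/andP; split; lra.
Qed.

Lemma height_continuous (R : realType) (T : topologicalType) (f g : T -> R) (k : R) :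
  continuous f -> continuous g ->
  continuous (fun t => f t * (1 - (g t - k) ^+ 2)).
Proof.
move=> cf cg t; apply: cvgM; first exact: cf.
have cd : g s - k @[s --> t] --> g t - k.
  by apply: cvgB; [exact: cg|exact: cvg_cst].
by apply: cvgB; [exact: cvg_cst|exact: (cvgM cd cd)].
Qed.

Section dendrite.
Variable R : realType.
Local Notation S := (@Sspace R).

(** Such a function u also separates, when z is in S: the point z is the only one of S where u
    takes the value u z, so a connected subset of S on which u takes values on
    both sides of u z contains z. *)
Definition chart_at (z : plane R) (u : plane R -> R) (al be : R) :=
  [/\ continuous u, al < u z < be &
      forall w w', S w -> S w' -> u w = u w' -> al < u w < be -> w = w'].

(** Off the stems the real part is a chart.  On the stem above k the chart is
    the height, extended by Im(w) (1 - (Re(w) - k)^2), which is continuous on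
    the plane and nonpositive on the rest of S. *)
Lemma chart_off_int (z : plane R) :
  S z -> (forall k : int, z != k%:~R) -> exists u al be, chart_at z u al be.
Proof.
move=> Sz zN; have [zr|] := pselect (forall k : int, complex.Re z != k%:~R).
  exists (fun w => complex.Re w), (Num.floor (complex.Re z))%:~R,
    (Num.floor (complex.Re z) + 1)%:~R; split.
  - exact: Re_continuous.
  - by rewrite floorD1_gt andbT lt_neqAle floor_le_tmp eq_sym zr.
  - move=> w w' Sw Sw' ww' wI.
    have off j : complex.Re w != j%:~R by exact: between_ints wI.
    have off' j : complex.Re w' != j%:~R by rewrite -ww'.
    by rewrite (S_off_int Sw off) (S_off_int Sw' off') ww'.
move=> /existsNP[k /negP/negPn/eqP zk].
have zi : 0 < complex.Im z <= 1.
  have : complex.Im z != 0.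
    apply/eqP => zi; move: (zN k); rewrite intr_on_axis => /eqP; apply.
    exact: plane_ext.
  by case: Sz => [/= ->|/= [_ /andP[i0 ->]] inz]; rewrite ?eqxx // lt_neqAle eq_sym inz i0.
pose u (w : plane R) := complex.Im w * (1 - (complex.Re w - k%:~R) ^+ 2).
have onstem w : S w -> 0 < u w -> complex.Re w = k%:~R.
  move=> [/= wi|/= [[j wj] /andP[i0 _]]]; rewrite /u.
    by rewrite wi mul0r ltxx.
  rewrite wj -intrB; have [->//|jk] := eqVneq j k.
  rewrite ltNge => /negP[]; apply: mulr_ge0_le0 => //.
  by rewrite subr_le0 -rmorphXn ler1z -gtz0_ge1 exprn_even_gt0 // subr_eq0.
have ustem w : complex.Re w = k%:~R -> u w = complex.Im w.
  by move=> wk; rewrite /u wk subrr expr0n subr0 mulr1.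
exists u, 0, 2; split.
- exact: height_continuous (@Im_continuous R) (@Re_continuous R).
- by rewrite ustem // ; case/andP: zi => -> /= i1; apply: le_lt_trans i1 _; rewrite ltr1n.
- move=> w w' Sw Sw' ww' /andP[uw _].
  have wk := onstem _ Sw uw; rewrite ww' in uw; have wk' := onstem _ Sw' uw.
  by apply: plane_ext; rewrite ?wk // -(ustem _ wk) ww' ustem.
Qed.

Definition injective_path (g : R -> plane R) (a b : R) :=
  [/\ continuous g, forall s, a <= s <= b -> S (g s) &
      forall s t, a <= s <= b -> a <= t <= b -> g s = g t -> s = t].

(** S contains no loop.  At a point of the path which is not an integer a chart
    crosses its value there, so a connected set containing both ends of the
    path contains the point.  The branching points, where there is no chart,
    are limits of such points. *)
Lemma path_in_connected (g : R -> plane R) (a b : R) (C : set (plane R)) :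
  injective_path g a b -> C `<=` S -> closed C -> connected C ->
  C (g a) -> C (g b) -> forall s, a <= s <= b -> C (g s).
Proof.
move=> [cg Sg inj] CS clC conC Ca Cb.
have off_int s : a <= s <= b -> (forall k : int, g s != k%:~R) -> C (g s).
  move=> sab gN; have [u [al [be [cu uI uinj]]]] := chart_off_int (Sg _ sab) gN.
  have cug : continuous (u \o g).
    by move=> t; apply: continuous_comp; [exact: cg|exact: cu].
  have cross := @injective_value_crossing R (u \o g) a s b al be cug sab.
  have iuC : is_interval (u @` C).
    apply/connected_intervalP; apply: connected_continuous_connected => //.
    exact: continuous_subspaceT.
  have [c Cc ucs] : (u @` C) (u (g s)).
    have inju r r' : a <= r <= b -> a <= r' <= b -> u (g r) = u (g r') ->
        al < u (g r) < be -> r = r'.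
      by move=> rab rab' e rI; apply: inj => //; apply: uinj => //; exact: Sg.
    case: (cross inju uI) => ab.
      by apply: (iuC (u (g a)) (u (g b))).
    by apply: (iuC (u (g b)) (u (g a))).
  have <- // : c = g s by apply: uinj; rewrite ?ucs //; [exact: CS|exact: Sg].
move=> s sab; have [[k gk]|gN] := pselect (exists k : int, g s = k%:~R); last first.
  by apply: off_int => // k; apply/eqP => e; apply: gN; exists k.
have [->//|sb] := eqVneq s b.
have {sb}lsb : s < b by rewrite lt_neqAle sb; case/andP: sab.
apply: (@closed_cvg _ _ s^'+ _ g C clC); last exact/cvg_at_right_filter/cg.
have near1 : \forall t \near s^'+, `|complex.Re (g s) - complex.Re (g t)| < 1.
  have cRg : complex.Re (g t) @[t --> s] --> complex.Re (g s).
    by apply: (@continuous_comp _ _ _ g (fun z => complex.Re z));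
      [exact: cg|exact: Re_continuous].
  by move/cvg_at_right_filter/cvgrPdist_lt: cRg; apply.
near=> t.
have st : s < t by near: t; exact: nbhs_right_gt.
have tab : a <= t <= b.
  apply/andP; split; last by near: t; exact: nbhs_right_le.
  by apply: le_trans (ltW st); case/andP: sab.
apply: off_int => // j; apply/eqP => gt.
have : `|complex.Re (g s) - complex.Re (g t)| < 1.
  by near: t.
rewrite gk gt !intr_on_axis /= -intrB -intr_norm ltrz1 => kj.
have kjE : k = j by lia.
have : s = t by apply: inj => //; rewrite gk gt kjE.
by move/eqP; rewrite lt_eqF.
Unshelve. all: by end_near. Qed.

End dendrite.

(** * Three-stars in S *)

Section stars.
Variable R : realType.
Local Notation S := (@Sspace R).
Implicit Types (X Q C : set (plane R)).

Lemma injective_path_sub (g : R -> plane R) (a b c : R) :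
  injective_path g a b -> c <= b -> injective_path g a c.
Proof.
move=> [cg Sg inj] cb; have wid s : a <= s <= c -> a <= s <= b.
  by move=> /andP[-> sc]; exact: le_trans cb.
by split=> // [s /wid|s t /wid ? /wid ?]; [exact: Sg|exact: inj].
Qed.

Lemma closed_connected_path (g : R -> plane R) (a b : R) :
  continuous g -> closed (g @` `[a, b]%classic) /\ connected (g @` `[a, b]%classic).
Proof.
move=> cg; split.
  apply: compact_closed; first exact: norm_hausdorff.
  apply: continuous_compact; last exact: segment_compact.
  exact: continuous_subspaceT.
apply: connected_continuous_connected; first exact: segment_connected.
exact: continuous_subspaceT.
Qed.

(** Retracting the line onto [0, 1] before applying the homeomorphism gives a
    parametrization continuous on the whole line, which is easier to compose
    than one continuous within [0, 1]. *)
Lemma segment_param X (y : plane R) :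
  segment_with_endpoint X y -> X `<=` S ->
  exists g : R -> plane R,
    [/\ injective_path g 0 1, g 0 = y & X = g @` `[0, 1]%classic].
Proof.
move=> [f [cf [f' [_ fX f'X fK f'K]]] fy] XS.
pose D : set R := `[0, 1]%classic.
have DE s : D s = (0 <= s <= 1) :> Prop by rewrite /D /= in_itv.
have param (k : R -> R) : continuous k -> (forall s, D (k s)) ->
    (forall s, D s -> k (k s) = s) -> f (k 0) = y -> 
    exists g : R -> plane R, [/\ injective_path g 0 1, g 0 = y & X = g @` D].
  move=> ck kD kK ky; exists (f \o k); split; [split| exact: ky |].
  - exact: (continuous_comp_within ck kD cf).
  - by move=> s _; apply: XS; apply: fX; exact: kD.
  - move=> s t s01 t01 fkst; have cancel r : f' (f (k r)) = k r by apply: fK; rewrite inE; exact: kD.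
    have kst : k s = k t by rewrite -cancel -(cancel t); congr f'.
    by rewrite -(kK s) ?DE // kst kK ?DE.
  - apply/seteqP; split => [x Xx|_ [s sD <-]]; last by apply: fX; exact: kD.
    exists (k (f' x)); first exact: kD.
    by rewrite /= kK ?f'K ?inE //; exact: f'X.
have cl01 s : 0 <= clamp (0 : R) 1 s <= 1 by exact: clamp_bounds.
case: fy => fy.
- apply: (param (clamp 0 1)).
  + exact: clamp_continuous.
  + by move=> s; rewrite DE.
  + by move=> s; rewrite DE => sD; rewrite !clamp_id // clamp_id.
  + by rewrite clamp_id // lexx ler01.
- apply: (param (fun s => 1 - clamp 0 1 s)).
  + by move=> s; apply: cvgB; [exact: cvg_cst|exact: clamp_continuous].
  + by move=> s; rewrite DE; case/andP: (cl01 s) => ? ?; apply/andP; split; lra.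
  + move=> s; rewrite DE => sD; rewrite (clamp_id sD) clamp_id ?subKr //.
    by case/andP: sD => ? ?; apply/andP; split; lra.
  + by rewrite clamp_id ?subr0 // lexx ler01.
Qed.

Definition star_arms X (m : plane R) (g : 'I_3 -> R -> plane R) :=
  [/\ forall i, injective_path (g i) 0 1, forall i, g i 0 = m,
      X = \bigcup_(i in [set: 'I_3]) (g i @` `[0, 1]%classic) &
      forall i j s t, i != j -> 0 <= s <= 1 -> 0 <= t <= 1 ->
        g i s = g j t -> s = 0].

Lemma three_star_arms X (m : plane R) :
  three_star X m -> X `<=` S -> exists g, star_arms X m g.
Proof.
move=> [A1 [A2 [A3 [XE [sA1 sA2 sA3] [A12 A13 A23]]]]] XS.
pose A (i : 'I_3) := if i == 0 then A1 else if i == 1 then A2 else A3.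
have AX i : A i `<=` X.
  by rewrite XE /A; case: ifP => _ x; [left; left|case: ifP => _; [left; right|right]].
have XA : X = \bigcup_(i in [set: 'I_3]) A i.
  apply/seteqP; split => [x|x [i _ /AX//]].
  rewrite XE => -[[xA|xA]|xA]; [exists 0|exists 1|exists (1 + 1)] => //.
have Am i j : i != j -> A i `&` A j = [set m].
  case: i j => [[|[|[|//]]] ?] [[|[|[|//]]] ?] //= _;
  by rewrite /A /= // setIC.
have sA i : segment_with_endpoint (A i) m by rewrite /A; case: ifP => _ //; case: ifP.
have /choice[g gP] : forall i, exists g : R -> plane R,
    [/\ injective_path g 0 1, g 0 = m & A i = g @` `[0, 1]%classic].
  by move=> i; apply: segment_param (sA i) _ => x /AX /XS.
exists g; split=> [i|i||].
- by case: (gP i).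
- by case: (gP i).
- by rewrite XA; apply: eq_bigcupr => i _; case: (gP i).
- move=> i j s t ij s01 t01 gst.
  have : (A i `&` A j) (g i s).
    have [[_ _ ->] [_ _ ->]] := (gP i, gP j).
    split; first by exists s => //; rewrite /= in_itv.
    by exists t; rewrite ?gst //= in_itv.
  rewrite Am // => /= gm; have [[_ _ inj] g0 _] := gP i.
  by apply: inj; rewrite ?g0 // lexx ler01.
Qed.

Lemma hull_subS Q : Q `<=` S -> hull Q `<=` S.
Proof.
by move=> QS; apply: smallest_sub => //; split=> //; [exact: closed_S|exact: connected_S].
Qed.

(** In the application e (i + 1) is G (a i), which type 3 puts on branch
    i + 1. *)
Record star_branches Q (m : plane R) (B : 'I_3 -> set (plane R))
    (a e : 'I_3 -> plane R) : Prop := StarBranches {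
  sb_component : forall i, exists2 z, (hull Q `\ m) z &
    B i = connected_component (hull Q `\ m) z;
  sb_inj : injective B;
  sb_a : forall i, B i (a i);
  sb_e : forall i, B i (e i);
  sb_eQ : forall i, Q (e i);
  sb_closest : forall i, hull [set m; a i] `&` Q = [set a i] }.

(** Each branch is one of the three arms without its end m, so a i and e i are
    on a common arm.  In the first claim a i comes first on it: were e i
    strictly between m and a i, it would lie in the hull of these two points,
    against the choice of a i.  In the second claim the arms are disjoint off
    m, so the part of arm i between m and e i, which lies in the union of C and
    of arm j, lies in C up to its end m; then m is in C since C is closed. *)
Lemma star_branches_order Q (m : plane R) B a e :
  Q `<=` S -> three_star (hull Q) m -> star_branches Q m B a e ->
  (forall i C, C `<=` S -> closed C -> connected C -> C m -> C (e i) ->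
     C (a i)) /\
  (forall i j C, C `<=` S -> closed C -> connected C -> i != j ->
     C (e i) -> C (e j) -> C m).
Proof.
move=> QS star [Bcc Binj Ba Be eQ closest].
have [g [gpath g0 XE gdisj]] := three_star_arms star (hull_subS QS).
pose Y := hull Q `\ m.
have onarm p : Y p -> exists k s, 0 < s <= 1 /\ p = g k s.
  move=> [Xp pm]; move: Xp; rewrite XE => -[k _ [s]].
  rewrite /= in_itv /= => /andP[s0 s1] gs; exists k, s; split=> //.
  rewrite s1 andbT lt_neqAle s0 andbT; apply/eqP => s0'.
  by apply: pm; rewrite -gs -s0' g0.
have pos s : 0 < s <= 1 -> (0 : R) <= s <= 1 by move=> /andP[/ltW -> ->].
have armY k s : 0 < s <= 1 -> Y (g k s).
  move=> s01; split; first by rewrite XE; exists k => //; exists s; rewrite //= in_itv pos.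
  move=> /= gm; have [_ _ inj] := gpath k.
  have s0 : s = 0 by apply: inj; rewrite ?g0 //; [exact: pos|rewrite lexx ler01].
  by move: s01; rewrite s0 ltxx.
have BY i p : B i p -> Y p.
  by have [z _ ->] := Bcc i; exact: connected_component_sub.
have same_branch i j k s t : 0 < s <= 1 -> 0 < t <= 1 ->
    B i (g k s) -> B j (g k t) -> i = j.
  move=> s01 t01 Bi Bj; apply: Binj.
  have cc : connected_component Y (g k s) (g k t).
    have mem r : 0 < r <= 1 -> (g k @` `]0, 1]%classic) (g k r).
      by exists r => //=; rewrite in_itv.
    apply: (@connected_component_max _ Y (g k @` `]0, 1]%classic)); last exact: mem.
    - exact: mem.
    - by move=> _ [r + <-]; rewrite /= in_itv => /armY.
    - apply: connected_continuous_connected.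
        by apply/connected_intervalP; exact: interval_is_interval.
      by apply: continuous_subspaceT; case: (gpath k).
  have [z _ Bz] := Bcc i; have [z' _ Bz'] := Bcc j.
  rewrite Bz Bz'; move: Bi Bj; rewrite Bz Bz'.
  move=> /same_connected_component -> /same_connected_component ->.
  exact: same_connected_component.
have /choice[k kP] : forall i, exists k, exists s r,
    [/\ 0 < s <= 1, 0 < r <= 1, a i = g k s & e i = g k r].
  have /choice[k kP] : forall i, exists k, exists2 s, 0 < s <= 1 & a i = g k s.
    by move=> i; have [k [s [s01 as']]] := onarm _ (BY _ _ (Ba i)); exists k, s.
  have kinj : injective k.
    move=> i j kij; have [[s s01 ai] [t t01 aj]] := (kP i, kP j).
    by apply: (same_branch i j (k i) s t) => //; rewrite ?kij -?ai -?aj // -kij -ai.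
  move=> i; exists (k i); have [s s01 ai] := kP i.
  have [k' [r [r01 er]]] := onarm _ (BY _ _ (Be i)).
  have /codomP[l k'l] := injF_onto kinj k'.
  have il : i = l.
    have [t t01 al] := kP l.
    by apply: (same_branch i l k' r t) => //; rewrite -?er // k'l -al.
  by exists s, r; split=> //; rewrite er k'l il.
split=> [i C CS clC conC Cm Ce|i j C CS clC conC ij Ci Cj].
- have [s [r [s01 r01 ai ei]]] := kP i.
  have [/andP[s0 s1] /andP[r0 r1]] := (s01, r01).
  have [sr|rs] := leP s r.
    rewrite ai; apply: (path_in_connected (injective_path_sub (gpath (k i)) r1)) => //.
    + by rewrite g0.
    + by rewrite -ei.
    + by rewrite sr ltW.
  have : (hull [set m; a i] `&` Q) (e i).
    split=> // A [[AS clA conA] mA]; rewrite ei.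
    apply: (path_in_connected (injective_path_sub (gpath (k i)) s1)) => //.
    + by rewrite g0; apply: mA; left.
    + by rewrite -ai; apply: mA; right.
    + by rewrite (ltW rs) ltW.
  by rewrite closest => /= <-.
- have [_ [r [_ /andP[r0 r1] _ ei]]] := kP i.
  have [_ [t [_ /andP[t0 t1] _ ej]]] := kP j.
  have kij : k i != k j.
    apply/eqP => kk; move/eqP: ij; apply.
    apply: (same_branch i j (k i) r t); rewrite ?r0 ?t0 // -?ei //.
    by rewrite kk -ej.
  have [[cgi Sgi _] [cgj Sgj _]] := (gpath (k i), gpath (k j)).
  pose C' := C `|` g (k j) @` `[0, t]%classic.
  have [clj conj] := closed_connected_path 0 t cgj.
  have C'S : C' `<=` S.
    move=> z [/CS//|[q + <-]]; rewrite /= in_itv /= => /andP[q0 qt].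
    by apply: Sgj; rewrite q0 (le_trans qt).
  have memj q : 0 <= q <= t -> C' (g (k j) q).
    by move=> qt; right; exists q => //=; rewrite in_itv.
  have C'i q : 0 <= q <= r -> C' (g (k i) q).
    apply: (path_in_connected (injective_path_sub (gpath (k i)) r1)) => //.
    + exact: closedU.
    + apply: connectedU => //; exists (e j); split=> //.
      by exists t; rewrite ?ej //= in_itv /= lexx ltW.
    + by rewrite g0 -(g0 (k j)); apply: memj; rewrite lexx ltW.
    + by left; rewrite -ei.
  rewrite -(g0 (k i)).
  apply: (@closed_cvg _ _ (0 : R)^'+ _ (g (k i)) C clC); last exact/cvg_at_right_filter/cgi.
  near=> q.
  have q0 : 0 < q by near: q; exact: nbhs_right_gt.
  have qr : q <= r by near: q; exact: nbhs_right_le.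
  have [//|[u + ug]] : C' (g (k i) q) by apply: C'i; rewrite qr ltW.
  rewrite /= in_itv /= => /andP[u0 ut].
  have q00 : q = 0.
    apply: (gdisj (k i) (k j) q u) => //.
      by rewrite (ltW q0) (le_trans qr).
    by rewrite u0 (le_trans ut).
  by move: q0; rewrite q00 ltxx.
Unshelve. all: by end_near. Qed.

End stars.

(** * Rotation numbers and periods *)

Section lifts.
Variables (R : realType) (F : plane R -> plane R).
Hypothesis hF : @L1 R F.
Local Notation S := (@Sspace R).

Lemma lift_S (z : plane R) : S z -> S (F z).
Proof. by case: hF => _ + _; exact. Qed.

Lemma iter_S (k : nat) (z : plane R) : S z -> S (iter k F z).
Proof. by move=> Sz; elim: k => //= k; exact: lift_S. Qed.

Lemma lift_shift (z : plane R) (j : int) :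
  S z -> F (z + j%:~R) = F z + j%:~R.
Proof.
case: hF => _ _ F1; elim: j z => [|j IH|j IH] z Sz.
- by rewrite !addr0.
- rewrite -addn1 PoszD intrD !addrA F1 ?IH //.
  exact: S_shift.
- have Sw : S (z + (- j.+1%:Z)%:~R) by exact: S_shift.
  apply: (addIr (1 : plane R)); rewrite -F1 // -addrA -[RHS]addrA.
  have -> : (- j.+1%:Z)%:~R + 1 = (- j%:Z)%:~R :> plane R.
    by rewrite -[1]/(1%:~R) -intrD; congr (_%:~R); lia.
  exact: IH.
Qed.

Lemma iter_shift (k : nat) (z : plane R) (j : int) :
  S z -> iter k F (z + j%:~R) = iter k F z + j%:~R.
Proof.
by move=> Sz; elim: k => //= k ->; apply: lift_shift; exact: iter_S.
Qed.

Lemma iter_mul_shift (r : nat) (j : int) (z : plane R) (k : nat) :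
  S z -> iter r F z = z + j%:~R -> iter (r * k) F z = z + (j * k%:Z)%:~R.
Proof.
move=> Sz rz; elim: k => [|k IH]; first by rewrite muln0 mulr0 addr0.
rewrite mulnS iterD IH iter_shift // rz -addrA -intrD; congr (_ + _%:~R).
by lia.
Qed.

(** Along an orbit that is periodic mod 1 the displacement differs from the
    linear growth j/r per step by a function of n mod r only. *)
Lemma periodic_rotation (z : plane R) (r : nat) (j : int) :
  S z -> (0 < r)%N -> iter r F z = z + j%:~R ->
  has_rotation_number F z (j%:~R / r%:R).
Proof.
move=> Sz r0 rz; rewrite /has_rotation_number.
have rn0 : (r%:R : R) != 0 by rewrite pnatr_eq0 -lt0n.
pose D (i : nat) := complex.Re (iter i F z) - complex.Re z - j%:~R / r%:R * i%:R.
pose M := \sum_(i < r) `|D i|.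
have DM n : `|D (n %% r)%N| <= M.
  have nr : (n %% r < r)%N by rewrite ltn_mod.
  by rewrite /M (bigD1 (Ordinal nr)) //= lerDl sumr_ge0.
have dev n : complex.Re (iter n F z) - complex.Re z =
    D (n %% r)%N + j%:~R / r%:R * n%:R.
  rewrite {1}(divn_eq n r) addnC iterD mulnC (iter_mul_shift _ Sz rz).
  rewrite iter_shift // ReD intr_on_axis /= /D.
  rewrite [in X in _ = _ + _ * X](divn_eq n r) natrD natrM intrM.
  by field.
apply/cvgrPdist_lt => eps eps0; near=> n.
have nM : M / eps < n%:R by near: n; exact: nbhs_infty_gtr.
have M0 : 0 <= M by apply: sumr_ge0.
have n0 : (0 : R) < n%:R by apply: le_lt_trans nM; exact: divr_ge0 (ltW _).
rewrite dev mulrDl mulfK ?gt_eqF // opprD addrCA subrr addr0 normrN.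
rewrite normrM normfV (gtr0_norm n0) ltr_pdivrMr //.
by apply: le_lt_trans (DM n) _; rewrite mulrC -ltr_pdivrMr.
Unshelve. all: by end_near. Qed.

Lemma periodic_rotation_eq (z : plane R) (r : nat) (j : int) (alpha : R) :
  S z -> (0 < r)%N -> iter r F z = z + j%:~R ->
  has_rotation_number F z alpha -> alpha = j%:~R / r%:R.
Proof.
move=> Sz r0 rz za; apply: (cvg_unique _ za (periodic_rotation Sz r0 rz)).
exact: norm_hausdorff.
Qed.

Lemma continuous_iter_lift (k : nat) (g : R -> plane R) :
  continuous g -> (forall t, S (g t)) -> continuous (iter k F \o g).
Proof.
move=> cg Sg; elim: k => [|k IH]; first exact: cg.
apply: (@continuous_comp_within _ _ _ (iter k F \o g) F S IH).
  by move=> t; exact: iter_S.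
by case: hF.
Qed.

End lifts.

Section slow_map.
Variables (R : realType) (F : plane R -> plane R) (p : int) (q : nat).
Hypotheses (hF : @L1 R F) (q0 : (0 < q)%N).
Local Notation S := (@Sspace R).

(** For k = q this is the map G, for k = q - 1 the factor g with
    g o F = F o g = G. *)
Definition descend (k : nat) (z : plane R) : plane R := iter k F z - p%:~R.

Lemma descend_S (k : nat) (z : plane R) : S z -> S (descend k z).
Proof. by move=> Sz; rewrite /descend -mulrNz; apply/S_shift/iter_S. Qed.

Lemma iter_descend_S (k s : nat) (z : plane R) : S z -> S (iter s (descend k) z).
Proof. by move=> Sz; elim: s => //= s; exact: descend_S. Qed.

Lemma iter_descend (s : nat) (z : plane R) : S z ->
  iter s (descend q) z = iter (q * s) F z - (p * s%:Z)%:~R.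
Proof.
move=> Sz; elim: s => [|s IH]; first by rewrite muln0 mulr0 subr0.
rewrite iterS IH /descend -!mulrNz iter_shift //; last exact: iter_S.
by rewrite -iterD -mulnS -addrA -intrD; congr (_ + _%:~R); lia.
Qed.

Lemma lift_descend (k : nat) (z : plane R) :
  S z -> F (descend k z) = descend k.+1 z.
Proof.
move=> Sz; rewrite /descend -mulrNz lift_shift //; exact: iter_S.
Qed.

Lemma lift_iter_descend (s : nat) (z : plane R) : S z ->
  F (iter s (descend q) z) = iter s (descend q) (F z).
Proof.
move=> Sz; elim: s => //= s <-; rewrite lift_descend; last exact: iter_descend_S.
by rewrite /descend iterSr.
Qed.

Lemma descend_period (z : plane R) (N : nat) :
  coprimez p q%:Z -> S z ->
  least_positive (fun k => iter k (descend q) z = z) N ->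
  mod1_period F z (q * N) /\ has_rotation_number F z (p%:~R / q%:R).
Proof.
move=> pq Sz [N0 Nz Nleast].
have qN0 : (0 < q * N)%N by rewrite muln_gt0 q0.
have Fz : iter (q * N) F z = z + (p * N%:Z)%:~R.
  by apply/eqP; rewrite -subr_eq -iter_descend // Nz.
have rot : has_rotation_number F z (p%:~R / q%:R).
  have := periodic_rotation hF Sz qN0 Fz.
  rewrite natrM intrM -mulf_div divff ?mulr1 // pnatr_eq0; lia.
split=> //; split=> //; first by exists (p * N%:Z).
move=> k k0 [j kz].
have := periodic_rotation_eq hF Sz k0 kz rot.
move/eqP; rewrite eqr_div ?pnatr_eq0 -?lt0n // !pmulrn -!intrM eqr_int => /eqP pk.
have qk : (q %| k)%N.
  have : (q%:Z %| p * k%:Z)%Z by rewrite pk; exact: dvdz_mull.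
  by rewrite Gauss_dvdzr // coprimez_sym.
have [s ks] := dvdnP qk; rewrite ks mulnC leq_pmul2r //.
have s0 : (0 < s)%N by move: k0; rewrite ks muln_gt0 => /andP[].
apply: Nleast => //; rewrite iter_descend // mulnC -ks kz.
suff -> : j = p * s%:Z by rewrite addrK.
apply: (@mulIf _ q%:Z); first by lia.
by rewrite -pk ks PoszM mulrA.
Qed.

Lemma period_multiple (z : plane R) (n : nat) :
  coprimez p q%:Z -> S z -> mod1_period F z n ->
  has_rotation_number F z (p%:~R / q%:R) -> (q %| n)%N.
Proof.
move=> pq Sz [n0 [j nz] _] rot.
have := periodic_rotation_eq hF Sz n0 nz rot.
move/eqP; rewrite eqr_div ?pnatr_eq0 -?lt0n // !pmulrn -!intrM eqr_int => /eqP pn.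
have : (q%:Z %| p * n%:Z)%Z by rewrite pn; exact: dvdz_mull.
by rewrite Gauss_dvdzr // coprimez_sym.
Qed.

End slow_map.

(** * Orbits of type 3 *)

Lemma exists_min_upto (R : realType) (f : nat -> R) (n : nat) : (0 < n)%N ->
  exists2 i, (i < n)%N & forall k, (k < n)%N -> f i <= f k.
Proof.
case: n => // n _; elim: n => [|n [i ni imin]].
  by exists 0%N => // -[].
have [ii|ii] := leP (f i) (f n.+1).
  exists i; first exact: ltnW.
  by move=> k; rewrite ltnS leq_eqVlt => /predU1P[->//|]; exact: imin.
exists n.+1 => // k; rewrite ltnS leq_eqVlt => /predU1P[->//|/imin].
exact: le_trans (ltW ii).
Qed.

Section type3.
Variables (R : realType) (G : plane R -> plane R) (Q : set (plane R)).
Variable m : plane R.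

Lemma true_periodic_orbit_stable (n : nat) :
  true_periodic_orbit G n Q -> forall z, Q z -> Q (G z).
Proof.
move=> [z [n0 nz _] ->] _ [k /= kn <-].
move: kn; rewrite leq_eqVlt => /predU1P[kn|kn]; last by exists k.+1.
by exists 0%N => //; rewrite -iterS kn nz.
Qed.

(** Having period 3 under phi excludes all the default values in the
    definitions of phi and of the closest point: a default value of phi would
    be a fixed point, and if m were the closest point to itself, its image
    G m = m would lie on a branch. *)
Lemma type3_branches : has_type G Q m 3 -> G m = m ->
  exists B a, star_branches Q m B a (fun i => G (a (i - 1))) /\
    forall i, Q (a i).
Proof.
move=> [[n Qorb] _ [[_ //]|[_ [b Brb [_ b3 bleast]]]]] Gm.
pose B (i : 'I_3) := iter i (phi G Q m) b.
have BS i : phi G Q m (B i) = B (i + 1).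
  by case: i => [[|[|[|//]]] ?]; rewrite /B.
have Binj : injective B.
  have neq (i j : 'I_3) : (i < j)%N -> B i <> B j.
    move=> ij /(congr1 (iter (3 - j) (phi G Q m))); rewrite -!iterD.
    rewrite subnK ?b3; last by have := ltn_ord j; lia.
    move=> /bleast; have := ltn_ord j; lia.
  move=> i j Bij; have [ij|ji|] := ltngtP i j; last exact: val_inj.
    by case: (neq _ _ ij Bij).
  by case: (neq _ _ ji (esym Bij)).
have next i : Br Q m (B (i + 1)) /\ B (i + 1) (G (sm Q m (B i))).
  rewrite -BS /phi; have [ex|nex] := pselect (exists c, Br Q m c /\ c (G (sm Q m (B i)))).
    exact: xgetPex ex.
  exfalso; have : B i = B (i + 1).
    by rewrite -BS /phi xgetPN // => c cP; apply: nex; exists c.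
  by move/Binj/eqP; rewrite (negbTE (neq_succ3 i)).
have BrB i : Br Q m (B i) by rewrite -(subrK 1 i); case: (next (i - 1)).
have offm i z : B i z -> z <> m.
  have [[w _ ->] _] := BrB i.
  by move=> /connected_component_sub[_ +].
pose a i := sm Q m (B i).
have aP i : [/\ Q (a i), B i (a i) & hull [set m; a i] `&` Q = [set a i]].
  rewrite /a /sm.
  have [ex|nex] := pselect (exists s, [/\ Q s, B i s & hull [set m; s] `&` Q = [set s]]).
    exact: xgetPex ex.
  exfalso; have [_] := next i; rewrite /sm xgetPN; last first.
    by move=> s sP; apply: nex; exists s.
  by rewrite Gm => /offm.
exists B, a; split; last by move=> i; case: (aP i).
split=> //.
- by move=> i; case: (BrB i).
- by move=> i; case: (aP i).
- by move=> i; have [_] := next (i - 1); rewrite subrK.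
- by move=> i; apply: (true_periodic_orbit_stable Qorb); case: (aP (i - 1)).
- by move=> i; case: (aP i).
Qed.

End type3.

(** * Clamping to a segment *)

Section clamping.
Variables (R : realType) (G : plane R -> plane R) (T : set (plane R)).
Variables (lo hi : R) (l : int).
Hypotheses (GS : forall z, @Sspace R z -> @Sspace R (G z))
  (lohi : lo <= hi) (llo : l%:~R <= lo) (hil : hi <= (l + 1)%:~R)
  (Tseg : forall z, T z -> exists2 x, lo <= x <= hi & z = on_axis x)
  (Tlo : T (on_axis lo)) (Thi : T (on_axis hi))
  (TG : forall z, T z -> T (G z)).

(** The interval map obtained from G by retracting onto the segment [lo, hi],
    the hull of the G-stable set T. *)
Definition clamped (x : R) : R :=
  clamp lo hi (complex.Re (G (on_axis (clamp lo hi x)))).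

Lemma clamped_bounds (x : R) : lo <= clamped x <= hi.
Proof. exact: clamp_bounds. Qed.

Lemma clamped_genuine (x y : R) :
  lo <= x <= hi -> lo <= y <= hi -> G (on_axis x) = on_axis y -> clamped x = y.
Proof. by move=> xI yI Gx; rewrite /clamped (clamp_id xI) Gx clamp_id. Qed.

Lemma clamped_on_T (x : R) :
  T (on_axis x) -> G (on_axis x) = on_axis (clamped x) /\ T (on_axis (clamped x)).
Proof.
move=> Tx; have [y yI Gx] := Tseg (TG Tx).
have xI : lo <= x <= hi.
  by have [x' x'I [->]] := Tseg Tx.
by rewrite (clamped_genuine xI yI Gx) -Gx; split=> //; exact: TG.
Qed.

(** The segment has no integer in its interior, so clamping changes a value of G
    only by sending it to an end.  Both ends belong to T, on which nothing is
    clamped, so a periodic orbit reaching an end is contained in T. *)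
Lemma clamped_periodic (x : R) (N : nat) :
  (0 < N)%N -> iter N clamped x = x ->
  forall s, iter s G (on_axis x) = on_axis (iter s clamped x).
Proof.
move=> N0 Nx.
have inI k : lo <= iter k clamped x <= hi.
  case: k => [|k]; last exact: clamped_bounds.
  by rewrite /= -Nx -(prednK N0); exact: clamped_bounds.
have stepG k : G (on_axis (iter k clamped x)) = on_axis (iter k.+1 clamped x).
  set y := iter k clamped x; have yI : lo <= y <= hi := inI k.
  rewrite iterS -/y.
  have [|ends] := boolP (lo < clamped y < hi).
    move=> int; have ReE := clamp_interior int.
    have Sz : @Sspace R (G (on_axis y)) by apply/GS/S_on_axis.
    rewrite /clamped (clamp_id yI) in int ReE *; rewrite ReE in int *.
    apply: S_off_int => // j; apply: (@between_ints _ _ l).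
    by case/andP: int => ? ?; apply/andP; split; [exact: le_lt_trans llo _|exact: lt_le_trans hil].
  (* The value is an endpoint, hence in T; the rest of the cycle, which comes
     back to y, is then a genuine orbit in T. *)
  suff Ty : T (on_axis y) by have [] := clamped_on_T Ty.
  have Tnext : T (on_axis (clamped y)).
    move: ends; have := clamped_bounds y; case/andP; rewrite le_eqVlt.
    move=> /predU1P[<- //|->]; rewrite le_eqVlt => /predU1P[-> //|->] //.
  have Titer s : T (on_axis (iter s clamped (clamped y))).
    by elim: s => //= s /clamped_on_T[].
  have := Titer N.-1; rewrite -iterSr prednK //.
  by rewrite /y -iterD addnC iterD Nx.
by elim=> //= s ->; exact: stepG.
Qed.

Lemma clamped_least_period (x : R) (N : nat) :
  least_positive (fun k => iter k clamped x = x) N ->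
  least_positive (fun k => iter k G (on_axis x) = on_axis x) N.
Proof.
move=> [N0 Nx Nleast]; have orbE := clamped_periodic N0 Nx.
split=> //; first by rewrite orbE Nx.
by move=> k k0; rewrite orbE => -[kx]; exact: Nleast.
Qed.

End clamping.

(** * Folding the star *)

Section assembly.
Variables (R : realType) (F : plane R -> plane R) (p : int) (q : nat).
Hypotheses (hF : @L1 R F) (q2 : (2 <= q)%N).
Local Notation S := (@Sspace R).
Local Notation G := (descend F p q).
Local Notation g := (descend F p q.-1).

Let q1 : q.-1.+1 = q.
Proof. by rewrite prednK // ltnW. Qed.

(** Images of real segments under g are among the sets that
    [star_branches_order] speaks of. *)
Lemma descend_image (x y : R) :
  let C := (fun t => g (on_axis t)) @` `[x, y]%classic in
  [/\ C `<=` S, closed C & connected C].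
Proof.
have cg : continuous (fun t => g (on_axis t)).
  have ci := continuous_iter_lift hF (k := q.-1) (@on_axis_continuous R) (@S_on_axis R).
  by move=> t; apply: cvgB; [exact: ci|exact: cvg_cst].
have [clC conC] := closed_connected_path x y cg.
by split=> // _ [t _ <-]; exact/(descend_S p hF)/S_on_axis.
Qed.

Lemma descend_lift (z : plane R) : g (F z) = G z.
Proof. by rewrite /descend -iterSr q1. Qed.

Lemma clamped_continuous (lo hi : R) : continuous (clamped G lo hi).
Proof.
have cc : continuous (@on_axis R \o clamp lo hi).
  by move=> t; apply: continuous_comp;
    [exact: clamp_continuous|exact: on_axis_continuous].
have ci := continuous_iter_lift hF (k := q) cc (fun t => @S_on_axis R _).
have cG : continuous (fun t => G (on_axis (clamp lo hi t))).
  by move=> t; apply: cvgB; [exact: ci|exact: cvg_cst].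
have cRe : continuous (fun t => complex.Re (G (on_axis (clamp lo hi t)))).
  move=> t; apply: (@continuous_comp _ _ _ (fun t => G (on_axis (clamp lo hi t)))
    (fun z => complex.Re z)); [exact: cG|exact: Re_continuous].
by move=> t; apply: (continuous_comp (cRe t)); exact: clamp_continuous.
Qed.

(** Pushing the star forward by F: the segment carries c = F m and
    b i = F (a i), and the two separation properties of the star become a
    [branch_covering] for G clamped to the hull of T. *)
Lemma folded_star_periods (x m : plane R) (n : nat) (l : int) :
  S x -> S m -> (0 < n)%N ->
  let Q := [set iter k G x | k in `I_n] in
  let T := [set iter k G (F x) | k in `I_n] in
  three_star (hull Q) m ->
  hull T `<=` [set z | complex.Im z = 0 /\ l%:~R <= complex.Re z <= (l + 1)%:~R] ->
  has_type G Q m 3 -> hull T (F m) -> G m = m ->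
  forall N, (0 < N)%N ->
  exists2 z, S z & least_positive (fun k => iter k G z = z) N.
Proof.
move=> Sx Sm n0 Q T star Tl type3 TFm Gm N N0.
have GS z : S z -> S (G z) by exact: descend_S.
have gS z : S z -> S (g z) by exact: descend_S.
have FgE z : S z -> F (g z) = G z.
  by move=> Sz; rewrite (lift_descend _ hF _ Sz) q1.
have QS : Q `<=` S by move=> _ [k _ <-]; exact: (iter_descend_S p hF).
have [B [a [branches Qa]]] := type3_branches type3 Gm.
have [through_a through_m] := star_branches_order QS star branches.
have [[n' Qorb] _ _] := type3.
have QT z : Q z -> T (F z).
  by move=> [k kn <-]; exists k => //; rewrite (lift_iter_descend p q hF).
have TQ z : T z -> exists2 w, Q w & z = F w.
  move=> [k kn <-]; exists (iter k G x); first by exists k.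
  by rewrite (lift_iter_descend p q hF).
have TG z : T z -> T (G z).
  move=> /TQ[w Qw ->]; rewrite -FgE ?descend_lift; last exact/(lift_S hF)/QS.
  by apply: QT; apply: (true_periodic_orbit_stable Qorb).
have Taxis z : T z -> z = on_axis (complex.Re z) /\
    l%:~R <= complex.Re z <= (l + 1)%:~R.
  move=> Tz; have [zi zl] : [set z : plane R | complex.Im z = 0 /\
      l%:~R <= complex.Re z <= (l + 1)%:~R] z by apply: Tl; exact: sub_gen_smallest.
  by split=> //; exact: plane_ext.
have [ilo ilon lomin] := exists_min_upto (fun k => complex.Re (iter k G (F x))) n0.
have [ihi ihin himax] := exists_min_upto (fun k => - complex.Re (iter k G (F x))) n0.
set lo := complex.Re (iter ilo G (F x)) in lomin.
pose hi := complex.Re (iter ihi G (F x)).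
have Tit k : (k < n)%N -> T (iter k G (F x)) by move=> kn; exists k.
have Tlo : T (on_axis lo) by have [<- _] := Taxis _ (Tit _ ilon); exact: Tit.
have Thi : T (on_axis hi) by have [<- _] := Taxis _ (Tit _ ihin); exact: Tit.
have llo : l%:~R <= lo by have [_ /andP[]] := Taxis _ Tlo.
have hil : hi <= (l + 1)%:~R by have [_ /andP[]] := Taxis _ Thi.
have Tseg z : T z -> exists2 t, lo <= t <= hi & z = on_axis t.
  move=> Tz; have [zE _] := Taxis _ Tz; exists (complex.Re z) => //.
  by case: Tz => k kn <-; rewrite lomin // -lerN2 himax.
have lohi : lo <= hi.
  by have [t /andP[lot thi] _] := Tseg _ Tlo; exact: le_trans lot thi.
have [c cI Fm] : exists2 c, lo <= c <= hi & F m = on_axis c.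
  have seg : hull T `<=` @on_axis R @` `[lo, hi]%classic.
    apply: smallest_sub; last first.
      by move=> z /Tseg[t tI ->]; exists t => //=; rewrite in_itv.
    have [clI conI] := closed_connected_path lo hi (@on_axis_continuous R).
    by split=> // _ [t _ <-]; exact: S_on_axis.
  by have [c + <-] := seg _ TFm; rewrite /= in_itv; exists c.
pose h := clamped G lo hi.
pose b i := complex.Re (F (a i)).
have FaE i : F (a i) = on_axis (b i) by have [-> _] := Taxis _ (QT _ (Qa i)).
have bI i : lo <= b i <= hi.
  by have [t tI] := Tseg _ (QT _ (Qa i)); rewrite FaE => -[->].
have gb i : g (on_axis (b i)) = G (a i) by rewrite -FaE descend_lift.
have bet s t u : lo <= s <= hi -> lo <= t <= hi ->
    Num.min s t <= u <= Num.max s t -> lo <= u <= hi.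
  move=> /andP[ls sh] /andP[lt th] /andP[mu uM]; apply/andP; split.
    by apply: le_trans mu; rewrite le_min ls.
  by apply: le_trans uM _; rewrite ge_max sh.
have hE u : lo <= u <= hi -> h u = clamp lo hi (complex.Re (F (g (on_axis u)))).
  by move=> uI; rewrite /h /clamped (clamp_id uI) FgE //; exact: S_on_axis.
pose Z : set R := [set u | lo <= u <= hi /\ g (on_axis u) = m].
have ends s t : let C := (fun r => g (on_axis r)) @` `[Num.min s t, Num.max s t]%classic in
    C (g (on_axis s)) /\ C (g (on_axis t)).
  by split; [exists s|exists t] => //=; rewrite in_itv /= ?ge_min ?le_max lexx ?orbT.
have bc : branch_covering h Z c b.
  split.
  - by split=> //; rewrite -Fm descend_lift.
  - by move=> u [uI gu]; rewrite hE // gu Fm clamp_id.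
  - move=> u i [uI gu].
    have [Cu Cb] := ends u (b i).
    have [CS clC conC] := descend_image (Num.min u (b i)) (Num.max u (b i)).
    have := through_a (i + 1) _ CS clC conC.
    rewrite addrK -gu -gb => /(_ Cu Cb)[v + gv]; rewrite /= in_itv => vI.
    exists v => //; rewrite hE ?gv; last exact: bet vI.
    by rewrite FaE /= clamp_id.
  - move=> i j ij.
    have [Ci Cj] := ends (b i) (b j).
    have [CS clC conC] := descend_image (Num.min (b i) (b j)) (Num.max (b i) (b j)).
    have := through_m (i + 1) (j + 1) _ CS clC conC.
    rewrite !addrK -!gb => /(_ _ Ci Cj)[|v + gv].
      by apply: contra ij => /eqP/addIr ->.
    by rewrite /= in_itv => vI; exists v => //; split=> //; exact: bet vI.
  - move=> i [_]; rewrite gb => Gam.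
    have [z _ Bz] := sb_component branches (i + 1).
    have := sb_e branches (i + 1); rewrite addrK Gam Bz.
    by move=> /connected_component_sub[_ /=].
have [t least] := branch_covering_periods (@clamped_continuous lo hi) bc N0.
exists (on_axis t); first exact: S_on_axis.
exact: (clamped_least_period GS lohi llo hil Tseg Tlo Thi TG).
Qed.

End assembly.

(** * The set of periods *)

Theorem theorem4 (R : realType) (F : plane R -> plane R) (hF : @L1 R F)
    (p : int) (q : nat) (hq : (2 <= q)%N) (hpq : coprimez p q%:Z)
    (n : nat) (hn : (0 < n)%N)
    (P : set (plane R))
    (hP : lifted_periodic_orbit F (n * q)%N P)
    (hrot : forall z, P z -> has_rotation_number F z (p%:~R / q%:R : R)) :
  let G : plane R -> plane R := fun z => iter q F z - p%:~R in
  let Pi (x : plane R) (i : nat) : set (plane R) :=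
    [set iter k G (iter i F x) | k in `I_n] in
  forall (x : plane R) (m : int),
    P x ->
    three_star (hull (Pi x 0%N)) (m%:~R : plane R) ->
    (exists l : int, hull (Pi x 1%N) `<=`
       [set z | complex.Im z = 0 /\ l%:~R <= complex.Re z <= (l + 1)%:~R]) ->
    has_type G (Pi x 0%N) (m%:~R : plane R) 3 ->
    (forall i : nat, (i < q)%N -> hull (Pi x i) (iter i F (m%:~R : plane R))) ->
    G (m%:~R : plane R) = m%:~R ->
  Per (p%:~R / q%:R : R) F = [set (q * k)%N | k in [set k | (0 < k)%N]].
Proof.
move=> G Pi x m Px star [l P1l] type3 Fm Gm.
have q0 : (0 < q)%N by exact: ltnW.
have Sx : @Sspace R x.
  case: hP => z [Sz _ PE]; move: Px; rewrite PE => -[k [j ->]].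
  exact/S_shift/(iter_S hF).
apply/seteqP; split => [k [z [Sz kz rot]]|_ [N /= N0 <-]].
  have /dvdnP[s ks] := period_multiple hF q0 hpq Sz kz rot.
  exists s; last by rewrite ks mulnC.
  by case: kz => + _ _; rewrite ks muln_gt0 => /andP[].
have [z Sz least] := folded_star_periods hF hq Sx (S_int R m) hn star P1l
  type3 (Fm 1%N hq) Gm N0.
have [per rot] := descend_period hF q0 hpq Sz least.
by exists z.
Qed.
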